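(* Let $\theta,\phi\in(0,2\pi/3)$ and let $S\subset\mathbb C^*$. (i) If $S\in A_{\theta,\phi}$, then the convex hull of $S$ is also in $A_{\theta,\phi}$. (ii) If $S\in A_{\theta,\phi}^2$ and $S$ is convex, then $S\in A_{\theta,\phi}$.
   Context: $\mathbb C^*=\mathbb C\setminus\{0\}$. For $u,v\in\mathbb C^*$, $\alpha(u,v)\in[0,\pi]$ denotes the angle between $u$ and $v$. The argument $\arg(z)$ takes values in $(-\pi,\pi]$. For $\theta,\phi\in(0,2\pi/3)$: $A_{\theta,\phi}$ is the set of all subsets $S\subset\mathbb C^*$ such that for every $n\ge 1$, every $u_1,\dots,u_n\in\mathbb C^*$ with $\alpha(u_i,u_j)\le\theta$ for all $i,j$, and every $a_1,\dots,a_n,b_1,\dots,b_n\in S$, the numbers $v=\sum_i a_iu_i$ and $w=\sum_i b_iu_i$ are nonzero and $\alpha(v,w)\le\phi$. $A_{\theta,\phi}^2$ is the set of all subsets $S\subset\mathbb C^*$ such that for all $a,b,c,d\in S$ the map $z\mapsto\frac{az+b}{cz+d}$ maps $\{z\in\mathbb C^*:|\arg(z)|\le\theta\}$ into $\{u\in\mathbb C^*:|\arg(u)|\le\phi\}$ (in particular $az+b\neq0$ and $cz+d\ne0$ for all such $z$). Equivalently, the defining condition of $A_{\theta,\phi}$ holds for $n=2$. *)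

(* Defs.v *)
From mathcomp Require Import all_boot all_order all_algebra.
From mathcomp Require Import all_classical all_reals all_analysis.
From mathcomp Require Import complex.

Set Implicit Arguments.
Unset Strict Implicit.
Unset Printing Implicit Defensive.

Import Order.TTheory GRing.Theory Num.Theory.
Import Normc.

Local Open Scope classical_set_scope.
Local Open Scope ring_scope.
Local Open Scope complex_scope.

(* The set of nonzero complex numbers. *)
Definition Cstar (R : realType) : set R[i] := [set z | z != 0].

(* Only meaningful for u and v nonzero, where it lies in [0, pi]. *)
Definition angle (R : realType) (u v : R[i]) : R :=
  acos (complex.Re (u * conjc v) / (normc u * normc v)).

(* Principal value, in ]-pi, pi], for z nonzero; see arg_itv and arg_polar. *)
Definition arg (R : realType) (z : R[i]) : R :=
  let t := acos (complex.Re z / normc z) in if 0 <= complex.Im z then t else - t.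

Lemma Re_div_normc_itv (R : realType) (z : R[i]) :
  -1 <= complex.Re z / normc z <= 1.
Proof.
have nz_ge0 : 0 <= normc z by case: z => a b; rewrite /= sqrtr_ge0.
have [->|nz0] := eqVneq (normc z) 0; first by rewrite invr0 mulr0 lerN10 ler01.
have nz_gt0 : 0 < normc z by rewrite lt_neqAle eq_sym nz0.
rewrite -ler_norml normrM normfV (gtr0_norm nz_gt0) ler_pdivrMr // mul1r.
by case: z {nz_ge0 nz0 nz_gt0} => a b /=; rewrite -sqrtr_sqr ler_wsqrtr // lerDl sqr_ge0.
Qed.

Lemma arg_polar (R : realType) (z : R[i]) : z != 0 ->
  z = (normc z * cos (arg z)) +i* (normc z * sin (arg z)).
Proof.
move=> z0; have itv := Re_div_normc_itv z.
have nz0 : normc z != 0 by apply: contra z0 => /eqP/eq0_normc ->.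
have nz_gt0 : 0 < normc z.
  by rewrite lt_neqAle eq_sym nz0; case: z {z0 itv nz0} => a b; rewrite /= sqrtr_ge0.
have cosE : cos (acos (complex.Re z / normc z)) = complex.Re z / normc z.
  by have [] := acos_def itv.
have sinE : normc z * sin (acos (complex.Re z / normc z)) = `|complex.Im z|.
  rewrite sin_acos // -{1}(gtr0_norm nz_gt0) -sqrtr_sqr -sqrtrM ?sqr_ge0 //.
  rewrite mulrBr mulr1 -exprMn mulrC mulfVK // -sqrtr_sqr.
  by case: (z) => a b /=; rewrite sqr_sqrtr ?addr_ge0 ?sqr_ge0 // addrC addKr.
rewrite /arg; case: (z) nz0 cosE sinE => a b nz0 /= cosE sinE.
case: ifPn => b0; rewrite ?cosN ?sinN ?mulrN cosE sinE mulrC mulfVK //.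
- by rewrite ger0_norm.
- by rewrite ltr0_norm ?opprK // ltNge.
Qed.

Lemma arg_itv (R : realType) (z : R[i]) : z != 0 -> - pi < arg z <= pi.
Proof.
move=> z0; have itv := Re_div_normc_itv z.
have [/andP[t0 tpi] _] := acos_def itv.
have pi0 := pi_gt0 R.
have := arg_polar z0; rewrite /arg; case: ifPn => Iz0 zE.
  by rewrite tpi andbT (lt_le_trans _ t0) // oppr_lt0.
have tNpi : acos (complex.Re z / normc z) != pi.
  apply: contraNneq Iz0 => tE; rewrite zE tE /= sinN sinpi oppr0 mulr0.
  exact: lexx.
rewrite ltrN2 lt_neqAle tNpi tpi /=.
by rewrite (le_trans _ (ltW pi0)) // oppr_le0.
Qed.

(* R[i] carries its structure of real vector space under the alias Rcomplex R. *)
Definition convexC (R : realType) (S : set R[i]) : Prop :=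
  @convex_set R (Rcomplex R) S.

Definition convex_hull (R : realType) (S : set R[i]) : set R[i] :=
  smallest (@convexC R) S.

Definition Aset (R : realType) (theta phi : R) : set (set R[i]) :=
  [set S | S `<=` @Cstar R /\
    forall (n : nat) (u a b : 'I_n -> R[i]), (1 <= n)%N ->
      (forall i, Cstar (u i)) ->
      (forall i j, angle (u i) (u j) <= theta) ->
      (forall i, S (a i)) -> (forall i, S (b i)) ->
      let v := \sum_(i < n) a i * u i in
      let w := \sum_(i < n) b i * u i in
      [/\ v != 0, w != 0 & angle v w <= phi]].

Definition sector (R : realType) (theta : R) : set R[i] :=
  [set z | z != 0 /\ `|arg z| <= theta].

(* Division by zero is total in R[i], so that the map z |-> (az+b)/(cz+d) is
   defined on the sector is required explicitly; az+b != 0 follows from the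
   image being in a sector, which excludes 0. *)
Definition A2set (R : realType) (theta phi : R) : set (set R[i]) :=
  [set S | S `<=` @Cstar R /\
    forall a b c d : R[i], S a -> S b -> S c -> S d ->
      forall z : R[i], sector theta z ->
        c * z + d != 0 /\ sector phi ((a * z + b) / (c * z + d))].

(* Main.v *)
(* Nonzero vectors at pairwise angles less than [2 * pi / 3] do not surround the
   origin.  Hence, if [v1], [v2] and [w] are pairwise within angle [phi], every
   nonnegative combination of [v1] and [v2] is within [phi] of [w]; this makes
   the bipolar, for the relation "angle at most [phi]", of the set of all sums
   [\sum_i a_i u_i] with [a_i] in [S] a convex set with pairwise angles at most
   [phi], which gives (i).  For (ii), all [u_i] lie in the cone spanned by two of
   them, say [x] and [y]; with [u_i = p_i x + q_i y], [P = \sum_i p_i] and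
   [Q = \sum_i q_i], convexity of [S] turns [\sum_i a_i u_i] into
   [c (P x) + d (Q y)] with [c] and [d] in [S], which is the case [n = 2] at
   [z = P x / (Q y)]. *)
Require Import Defs.
From mathcomp Require Import all_boot all_order all_algebra.
From mathcomp Require Import all_classical all_reals all_analysis.
From mathcomp Require Import complex.
From mathcomp Require Import ring lra.
Set Implicit Arguments.
Unset Strict Implicit.
Unset Printing Implicit Defensive.
Import Order.TTheory GRing.Theory Num.Theory.
Import Normc.
Local Open Scope classical_set_scope.
Local Open Scope ring_scope.
Local Open Scope complex_scope.

(** * Nearness of directions and cones in the plane *)

Section PlaneGeometry.
Variable R : realType.
Implicit Types (u v w x y z : R[i]) (t l m p q : R).

Definition dot u v : R :=
  complex.Re u * complex.Re v + complex.Im u * complex.Im v.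
Definition cross u v : R :=
  complex.Re u * complex.Im v - complex.Im u * complex.Re v.

(* For [t] the cotangent of [phi] in ]0, pi[ and [u], [v] nonzero, this says
   that the angle between [u] and [v] is at most [phi]; see [angle_le]. *)
Definition near_dir t u v := t * `|cross u v| <= dot u v.

Lemma dotC u v : dot u v = dot v u.
Proof. by rewrite /dot; ring. Qed.

Lemma crossC u v : cross u v = - cross v u.
Proof. by rewrite /cross; ring. Qed.

Lemma dot_comb l m u v w :
  dot (l%:C * u + m%:C * v) w = l * dot u w + m * dot v w.
Proof. by case: u v w => [a b] [c d] [e f]; rewrite /dot /=; ring. Qed.

Lemma cross_comb l m u v w :
  cross (l%:C * u + m%:C * v) w = l * cross u w + m * cross v w.
Proof. by case: u v w => [a b] [c d] [e f]; rewrite /cross /=; ring. Qed.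

Lemma dotZ l m u v : dot (l%:C * u) (m%:C * v) = l * m * dot u v.
Proof. by case: u v => [a b] [c d]; rewrite /dot /=; ring. Qed.

Lemma crossZ l m u v : cross (l%:C * u) (m%:C * v) = l * m * cross u v.
Proof. by case: u v => [a b] [c d]; rewrite /cross /=; ring. Qed.

Lemma dot_gt0 u : u != 0 -> 0 < dot u u.
Proof.
case: u => a b u0; rewrite /dot /= -!expr2 lt_neqAle addr_ge0 ?sqr_ge0 // andbT.
rewrite eq_sym paddr_eq0 ?sqr_ge0 // !sqrf_eq0.
by apply: contra u0 => /andP[/eqP -> /eqP ->].
Qed.

Lemma near_dirC t u v : near_dir t u v -> near_dir t v u.
Proof. by rewrite /near_dir dotC crossC normrN. Qed.

Lemma near_dirZ t l m u v : 0 <= l -> 0 <= m ->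
  near_dir t u v -> near_dir t (l%:C * u) (m%:C * v).
Proof.
move=> l0 m0 uv; rewrite /near_dir dotZ crossZ normrM ger0_norm ?mulr_ge0 //.
by rewrite mulrCA ler_wpM2l ?mulr_ge0.
Qed.

(* For [t] the cotangent of an angle in ]0, pi[, this says that the angle is
   less than [2 * pi / 3]. *)
Definition cot_lt23pi t := 0 <= t \/ 3 * t ^+ 2 < 1.

(* Three pairwise angles less than [2 * pi / 3] cannot add up to [2 * pi], so
   the three directions do not go around the origin. *)
Lemma near_dir_no_turn t x y z : cot_lt23pi t -> y != 0 ->
  near_dir t x y -> near_dir t y z -> near_dir t z x ->
  0 < cross x y -> 0 < cross y z -> cross z x <= 0.
Proof.
move=> ht /dot_gt0 n0; rewrite /near_dir => hxy hyz hzx a0 b0.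
rewrite leNgt; apply/negP => c0.
(* [Ec] and [Ed] are the addition formulas for the signed angle from [z] to [x], which is minus the
   sum of those from [x] to [y] and from [y] to [z]. *)
have Ec : dot y y * cross z x = - (cross x y * dot y z + cross y z * dot x y).
  by rewrite /cross /dot; ring.
have Ed : dot y y * dot z x = dot x y * dot y z - cross x y * cross y z.
  by rewrite /cross /dot; ring.
move: hxy hyz hzx; rewrite !gtr0_norm // => hxy hyz hzx.
move: Ec Ed; move: (dot y y) (cross z x) (dot z x) (cross x y) (cross y z)
  (dot x y) (dot y z) n0 a0 b0 c0 hxy hyz hzx => n c d a b A B.
move=> n0 a0 b0 c0 hA hB hd Ec Ed.
have S0 : a * B + b * A < 0.
  by rewrite -oppr_gt0 -Ec mulr_gt0.
have hdn : - t * (a * B + b * A) <= A * B - a * b.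
  by rewrite -Ed mulNr -mulrN -Ec mulrCA ler_wpM2l // ltW.
have bA : b * (A + t * a) < 0.
  have : a * (t * b) <= a * B by rewrite ler_wpM2l // ltW.
  lra.
have aB : a * (B + t * b) < 0.
  have : b * (t * a) <= b * A by rewrite ler_wpM2l // ltW.
  lra.
rewrite pmulr_rlt0 // in bA; rewrite pmulr_rlt0 // in aB.
have ab0 : 0 < a * b by rewrite mulr_gt0.
case: ht => [t0|t0].
  by have : 0 <= t * a by [rewrite mulr_ge0 // ltW]; lra.
(* By [bA] and [aB] the left factors are positive; [hA] and [hB] bound them by the right ones.
   Expanding and using [hdn] leaves [(1 - 3 * t ^+ 2) * (a * b) <= 0]. *)
have k1 : (- A - t * a) * (- B - t * b) <= (- (2 * t) * a) * (- (2 * t) * b).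
  by apply: ler_pM; lra.
have k2 : (3 * t ^+ 2 - 1) * (a * b) < 0 by rewrite pmulr_llt0 // subr_lt0.
move: k1 k2 hdn; rewrite expr2; lra.
Qed.

(** When [u] and [v] lie on one side of the line through [w], the absolute values add without
    cancellation and so do the two inequalities. Nearness of [u] to [v] matters when [w] separates
    them. *)
Lemma near_dir_comb t l m u v w : cot_lt23pi t -> w != 0 ->
  0 <= l -> 0 <= m ->
  near_dir t u v -> near_dir t u w -> near_dir t v w ->
  near_dir t (l%:C * u + m%:C * v) w.
Proof.
move=> ht w0.
(* If [w] lies in the cone of [u] and [v], the absence of a full turn puts the
   ray of [w] itself, not that of [- w], on the way from [u] to [v]. *)
have opp l' m' u' v' : 0 <= l' -> 0 <= m' ->
    near_dir t u' v' -> near_dir t u' w -> near_dir t v' w ->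
    0 < cross u' w -> cross v' w < 0 ->
    near_dir t (l'%:C * u' + m'%:C * v') w.
  move=> l0 m0 uv uw vw X1 X2.
  have X3 : 0 < cross w v' by rewrite crossC oppr_gt0.
  have N0 : 0 <= cross u' w * dot v' w - cross v' w * dot u' w.
    have := near_dir_no_turn ht w0 uw (near_dirC vw) (near_dirC uv) X1 X3.
    rewrite -(pmulr_rle0 _ (dot_gt0 w0)).
    have -> : dot w w * cross v' u' =
      - (cross u' w * dot v' w - cross v' w * dot u' w).
      by rewrite /cross /dot; ring.
    by rewrite oppr_le0.
  move: uw vw; rewrite /near_dir dot_comb cross_comb gtr0_norm // ltr0_norm //.
  move: (cross u' w) (cross v' w) (dot u' w) (dot v' w) X1 X2 N0.
  move=> a b A B a0 b0 N0 hA hB.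
  (* Here [a * (l' * A + m' * B)] is [A * (l' * a + m' * b)] plus the nonnegative term
     [m' * (a * B - b * A)]. For the other sign, [- b] and [B] take the roles of [a] and [A]. *)
  have [c0|c0] := ger0P (l' * a + m' * b).
    rewrite -(ler_pM2l a0).
    have h1 : 0 <= m' * (a * B - b * A) by rewrite mulr_ge0.
    have h2 : t * a * (l' * a + m' * b) <= A * (l' * a + m' * b).
      by rewrite ler_wpM2r.
    lra.
  have b'0 : 0 < - b by rewrite oppr_gt0.
  rewrite -(ler_pM2l b'0).
  have h1 : 0 <= l' * (a * B - b * A) by rewrite mulr_ge0.
  have h2 : t * - b * - (l' * a + m' * b) <= B * - (l' * a + m' * b).
    by rewrite ler_wpM2r // oppr_ge0 ltW.
  lra.
move=> l0 m0 uv uw vw.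
have [X1|X1] := ltP 0 (cross u w); have [X2|X2] := ltP (cross v w) 0.
- by apply: opp.
- have X3 : 0 <= l * cross u w + m * cross v w.
    by rewrite addr_ge0 // mulr_ge0 // ltW.
  move: uw vw; rewrite /near_dir dot_comb cross_comb.
  rewrite (ger0_norm X3) (ger0_norm X2) (gtr0_norm X1) => h1 h2.
  have := ler_wpM2l l0 h1; have := ler_wpM2l m0 h2; lra.
- have X3 : l * cross u w + m * cross v w <= 0.
    by rewrite -oppr_ge0 opprD -!mulrN addr_ge0 // mulr_ge0 // oppr_ge0 // ltW.
  move: uw vw; rewrite /near_dir dot_comb cross_comb.
  rewrite (ler0_norm X3) (ler0_norm X1) (ltr0_norm X2) => h1 h2.
  have := ler_wpM2l l0 h1; have := ler_wpM2l m0 h2; lra.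
- have [X2'|X2'] := ltP 0 (cross v w); last first.
    have X20 : cross v w = 0 by apply/eqP; rewrite eq_le X2 X2'.
    move: uw vw; rewrite /near_dir dot_comb cross_comb X20 mulr0 addr0.
    rewrite normrM (ger0_norm l0) normr0 => h1 h2.
    have := ler_wpM2l l0 h1; have := ler_wpM2l m0 h2; lra.
  have [X1'|X1'] := ltP (cross u w) 0.
    by rewrite addrC; apply: opp => //; exact: near_dirC.
  have X10 : cross u w = 0 by apply/eqP; rewrite eq_le X1 X1'.
  move: uw vw; rewrite /near_dir dot_comb cross_comb X10 mulr0 add0r.
  rewrite normrM (ger0_norm m0) normr0 => h1 h2.
  have := ler_wpM2l l0 h1; have := ler_wpM2l m0 h2; lra.
Qed.

(** A vanishing combination forces [cross u v = 0]; nearness then gives [0 <= dot u v] whatever [t]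
    is, so the vectors cannot be opposite. *)
Lemma near_dir_comb_neq0 t l m u v : u != 0 -> v != 0 ->
  0 <= l -> 0 <= m -> 0 < l + m ->
  near_dir t u v -> l%:C * u + m%:C * v != 0.
Proof.
move=> /dot_gt0 u0 /dot_gt0 v0 l0 m0 lm uv; apply/eqP => E.
have d0 z : dot 0 z = 0 by rewrite /dot /= !mul0r addr0.
have c0 z : cross 0 z = 0 by rewrite /cross /= !mul0r subrr.
have X0 : cross u v = 0.
  have := cross_comb l m u v v; have := cross_comb l m u v u.
  rewrite E !c0 [cross v u]crossC => h1 h2.
  have uu : cross u u = 0 by rewrite /cross; ring.
  have vv : cross v v = 0 by rewrite /cross; ring.
  move: h1 h2; rewrite uu vv => h1 h2.
  have /eqP : (l + m) * cross u v = 0 by lra.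
  by rewrite mulf_eq0 gt_eqF //= => /eqP.
move: uv; rewrite /near_dir X0 normr0 mulr0 => D0.
have h1 := dot_comb l m u v u; have h2 := dot_comb l m u v v.
move: h1 h2; rewrite E !d0 [dot v u]dotC => h1 h2.
have a1 : 0 <= l * dot u u by rewrite mulr_ge0 // ltW.
have a2 : 0 <= m * dot v v by rewrite mulr_ge0 // ltW.
have a3 : 0 <= l * dot u v by rewrite mulr_ge0.
have a4 : 0 <= m * dot u v by rewrite mulr_ge0.
have l00 : l = 0.
  have /eqP : l * dot u u = 0 by lra.
  by rewrite mulf_eq0 (gt_eqF u0) orbF => /eqP.
have m00 : m = 0.
  have /eqP : m * dot v v = 0 by lra.
  by rewrite mulf_eq0 (gt_eqF v0) orbF => /eqP.
by move: lm; rewrite l00 m00 addr0 ltxx.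
Qed.

Definition in_cone x y z :=
  exists p q, [/\ 0 <= p, 0 <= q & z = p%:C * x + q%:C * y].

Lemma in_coneC x y z : in_cone x y z -> in_cone y x z.
Proof. by move=> [p [q [p0 q0 ->]]]; exists q, p; rewrite addrC. Qed.

(** Cramer's rule, as a linear dependence between three plane vectors. *)
Lemma cross_relation x y z :
  (cross y z)%:C * x + (cross z x)%:C * y + (cross x y)%:C * z = 0.
Proof.
case: x y z => [a b] [c d] [e f]; rewrite /cross; simpc.
by apply/eqP; rewrite eq_complex /=; apply/andP; split; apply/eqP; ring.
Qed.

Lemma in_cone_relation p q r x y z : r != 0 -> p * r <= 0 -> q * r <= 0 ->
  p%:C * x + q%:C * y + r%:C * z = 0 -> in_cone x y z.
Proof.
move=> r0 pr qr E.
have ge0 s : s * r <= 0 -> 0 <= - (s / r).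
  move=> sr; have -> : - (s / r) = - (s * r) / (r ^+ 2) by field.
  by rewrite divr_ge0 ?sqr_ge0 // oppr_ge0.
exists (- (p / r)), (- (q / r)); split; rewrite ?ge0 //.
have rC : r%:C != 0 :> R[i] by rewrite eq_complex /= eqxx andbT.
apply: (mulfI rC); rewrite mulrDr !mulrA -!rmorphM /=.
have e s : r * - (s / r) = - s by field.
rewrite !e !rmorphN /= !mulNr -opprD; apply/eqP.
by rewrite -addr_eq0 addrC E.
Qed.

Lemma near_dir_parallel_in_cone t x y z : x != 0 ->
  near_dir t x z -> cross x z = 0 -> in_cone x y z.
Proof.
move=> /dot_gt0 x0 xz X0; move: xz; rewrite /near_dir X0 normr0 mulr0 => D0.
exists (dot x z / dot x x), 0; split=> //; first by rewrite divr_ge0 // ltW.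
rewrite mul0r addr0; case: x z x0 X0 D0 => [a b] [c d].
rewrite /cross /dot /= => x0 X0 _; simpc.
apply/eqP; rewrite eq_complex /=; apply/andP; split; apply/eqP.
- apply: (mulIf (lt0r_neq0 x0)); rewrite mulrAC mulfVK ?lt0r_neq0 //.
  apply/eqP; rewrite -subr_eq0 -[X in _ == X](mulr0 (- b)) -X0.
  by apply/eqP; ring.
- apply: (mulIf (lt0r_neq0 x0)); rewrite mulrAC mulfVK ?lt0r_neq0 //.
  by apply/eqP; rewrite -subr_eq0 -[X in _ == X](mulr0 a) -X0; apply/eqP; ring.
Qed.


(** If no cross product vanishes, [near_dir_no_turn], for both orientations, keeps the three
    coefficients of [cross_relation] from having the same sign. The vector whose coefficient has the
    odd sign is then in the cone of the other two. *)
Lemma near_dir_in_cone t x y z : cot_lt23pi t ->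
  x != 0 -> y != 0 -> z != 0 ->
  near_dir t x y -> near_dir t y z -> near_dir t z x ->
  [\/ in_cone x y z, in_cone y z x | in_cone z x y].
Proof.
move=> ht x0 y0 z0 xy yz zx.
have [p0|p0] := eqVneq (cross y z) 0.
  by apply: Or31; apply/in_coneC/(near_dir_parallel_in_cone _ y0 yz).
have [q0|q0] := eqVneq (cross z x) 0.
  by apply: Or32; apply/in_coneC/(near_dir_parallel_in_cone _ z0 zx).
have [r0|r0] := eqVneq (cross x y) 0.
  by apply: Or33; apply/in_coneC/(near_dir_parallel_in_cone _ x0 xy).
have rel := cross_relation x y z.
have relx : (cross z x)%:C * y + (cross x y)%:C * z + (cross y z)%:C * x = 0.
  by rewrite -rel; ring.
have rely : (cross x y)%:C * z + (cross y z)%:C * x + (cross z x)%:C * y = 0.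
  by rewrite -rel; ring.
have turn1 := near_dir_no_turn ht y0 xy yz zx.
have turn2 := near_dir_no_turn ht y0 (near_dirC yz) (near_dirC xy) (near_dirC zx).
move: turn1 turn2; rewrite [cross z y]crossC [cross y x]crossC [cross x z]crossC.
rewrite !oppr_gt0 oppr_le0 => turn1 turn2.
have mixed (a b : R) : 0 < a -> b < 0 -> a * b <= 0 /\ b * a <= 0.
  by move=> a0 b0; rewrite [b * a]mulrC; split; rewrite mulr_ge0_le0 // ltW.
case: (ltgtP (cross y z) 0) p0 => // p0 _;
  case: (ltgtP (cross z x) 0) q0 => // q0 _;
  case: (ltgtP (cross x y) 0) r0 => // r0 _.
- by have := turn2 p0 r0; rewrite leNgt q0.
- by apply: Or31; apply: (in_cone_relation _ _ _ rel);
    rewrite ?(gt_eqF r0) //;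
    have [? ?] := mixed _ _ r0 p0;
    have [? ?] := mixed _ _ r0 q0.
- by apply: Or33; apply: (in_cone_relation _ _ _ rely);
    rewrite ?(gt_eqF q0) //;
    have [? ?] := mixed _ _ q0 p0;
    have [? ?] := mixed _ _ q0 r0.
- by apply: Or32; apply: (in_cone_relation _ _ _ relx);
    rewrite ?(lt_eqF p0) //;
    have [? ?] := mixed _ _ q0 p0;
    have [? ?] := mixed _ _ r0 p0.
- by apply: Or32; apply: (in_cone_relation _ _ _ relx);
    rewrite ?(gt_eqF p0) //;
    have [? ?] := mixed _ _ p0 q0;
    have [? ?] := mixed _ _ p0 r0.
- by apply: Or33; apply: (in_cone_relation _ _ _ rely);
    rewrite ?(lt_eqF q0) //;
    have [? ?] := mixed _ _ p0 q0;
    have [? ?] := mixed _ _ r0 q0.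
- by apply: Or31; apply: (in_cone_relation _ _ _ rel);
    rewrite ?(lt_eqF r0) //;
    have [? ?] := mixed _ _ p0 r0;
    have [? ?] := mixed _ _ q0 r0.
- by have := turn1 r0 p0; rewrite leNgt q0.
Qed.

End PlaneGeometry.

(** * From angles and arguments to cotangent inequalities *)

Section Angles.
Variable R : realType.
Implicit Types (u v z : R[i]) (phi : R).

Definition cot phi : R := cos phi / sin phi.

Lemma cot_lt23piP phi : 0 < phi < 2 * pi / 3 -> cot_lt23pi (cot phi).
Proof.
move=> /andP[phi0 phi23]; have pi0 := pi_gt0 R.
have s0 : 0 < sin phi by apply: sin_gt0_pi; lra.
have [phi2|phi2] := leP phi (pi / 2).
  by left; rewrite divr_ge0 ?(ltW s0) // cos_ge0_pihalf //; lra.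
right; rewrite /cot expr_div_n mulrA ltr_pdivrMr ?exprn_gt0 // mul1r.
(* Beyond [pi / 2], the bound on [phi] says that [sin (3 * phi)] is negative, and this sine equals
   [sin phi * (3 * cos phi ^+ 2 - sin phi ^+ 2)]. *)
have : 0 < sin (phi + phi + phi - pi) by apply: sin_gt0_pi; lra.
rewrite sinB cospi sinpi mulr0 subr0 mulrN1 oppr_gt0 !sinD !cosD.
have := cos2Dsin2 phi; move: (sin phi) (cos phi) s0 => s c s0 cs.
have -> : (s * c + c * s) * c + (c * c - s * s) * s = s * (3 * c ^+ 2 - s ^+ 2).
  by ring.
by rewrite pmulr_rlt0 // subr_lt0.
Qed.

(** With [a] the arc cosine, both sides say that [sin (phi - a)] is nonnegative, since [phi - a]
    lies strictly between [- pi] and [pi]. *)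
Lemma acos_le_cot phi (d x : R) : 0 < phi < pi -> 0 < d ^+ 2 + x ^+ 2 ->
  (acos (d / Num.sqrt (d ^+ 2 + x ^+ 2)) <= phi) = (cot phi * `|x| <= d).
Proof.
move=> /andP[phi0 phipi] r0; set r := Num.sqrt _.
have rp : 0 < r by rewrite sqrtr_gt0.
have r2 : r ^+ 2 = d ^+ 2 + x ^+ 2 by rewrite sqr_sqrtr // ltW.
have s0 : 0 < sin phi by apply: sin_gt0_pi; rewrite phi0.
have itv : -1 <= d / r <= 1.
  rewrite -ler_norml normrM normfV (gtr0_norm rp) ler_pdivrMr // mul1r.
  by rewrite -sqrtr_sqr ler_wsqrtr // lerDl sqr_ge0.
have [a0pi cosE] := acos_def itv; have sinE := sin_acos itv.
have {}sinE : sin (acos (d / r)) = `|x| / r.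
  rewrite sinE expr_div_n r2 -[1](divff (lt0r_neq0 r0)) -mulrBl addrC addKr.
  by rewrite sqrtrM ?sqr_ge0 // sqrtr_sqr sqrtrV // ltW.
move: (acos _) a0pi cosE sinE => a /andP[a0 api] cosE sinE.
have -> : (cot phi * `|x| <= d) = (0 <= sin (phi - a)).
  rewrite sinB cosE sinE subr_ge0 /cot mulrAC ler_pdivrMr // !mulrA.
  by rewrite ler_pM2r ?invr_gt0 // [d * _]mulrC.
have [ap|ap] := leP a phi.
  by rewrite sin_ge0_pi //; apply/andP; split; lra.
have : 0 < sin (a - phi) by apply: sin_gt0_pi; apply/andP; split; lra.
by rewrite -opprB sinN oppr_gt0 ltNge => /negbTE ->.
Qed.

Lemma angle_le phi u v : 0 < phi < pi -> u != 0 -> v != 0 ->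
  (angle u v <= phi) = near_dir (cot phi) u v.
Proof.
move=> hphi u0 v0; rewrite /angle /near_dir.
(* Lagrange's identity. *)
have E : dot u v ^+ 2 + cross u v ^+ 2 = dot u u * dot v v.
  by rewrite /dot /cross; ring.
have -> : normc u * normc v = Num.sqrt (dot u v ^+ 2 + cross u v ^+ 2).
  rewrite E sqrtrM ?(ltW (dot_gt0 u0)) //.
  by case: (u) (v) => [a b] [c d]; rewrite /dot /= -!expr2.
have -> : complex.Re (u * conjc v) = dot u v.
  by case: (u) (v) => [a b] [c d]; rewrite /dot /=; ring.
by rewrite acos_le_cot // E mulr_gt0 ?dot_gt0.
Qed.

(** This translates the sectors of [A2set] into the angles of [Aset]. *)
Lemma norm_arg_div u v : v != 0 -> `|arg (u / v)| = angle u v.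
Proof.
move=> v0; have norm_arg z : `|arg z| = acos (complex.Re z / normc z).
  have := acos_ge0 (Re_div_normc_itv z).
  by rewrite /arg; case: ifP => _ h; rewrite ?normrN ger0_norm.
rewrite norm_arg /angle normcM normcV; congr acos.
have n0 : normc v != 0 by apply: contra v0 => /eqP/eq0_normc ->.
have n2 : normc v ^+ 2 = dot v v.
  case: (v) => c d; rewrite /dot /= sqr_sqrtr ?addr_ge0 ?sqr_ge0 //.
have -> : complex.Re (u / v) = complex.Re (u * conjc v) / normc v ^+ 2.
  rewrite n2; case: (u) (v) => [a b] [c d]; rewrite /dot /= -!expr2.
  by ring.
rewrite (invfM (normc u)) invrK (invfM (normc u)).
by move: (normc u)^-1 => p; field.
Qed.

End Angles.

(** * Convex combinations and sums with coefficients in a hull *)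

Section Convexity.
Variable R : realType.
Implicit Types (S W : set R[i]) (l m : R).

Lemma convexCP S : convexC S <->
  (forall l m x y, 0 <= l -> 0 <= m -> l + m = 1 -> S x -> S y ->
     S (l%:C * x + m%:C * y)).
Proof.
have convE (k : {i01 R}) (x y : R[i]) :
    @conv R (convex_lmodType (Rcomplex R)) k x y =
    (k%:num)%:C * x + (1 - k%:num)%:C * y :> R[i].
  by case: x y => [a b] [c d]; rewrite /conv /=; simpc.
split=> [cS l m x y l0 m0 lm Sx Sy | cS x y k].
  have l1 : l <= 1 by rewrite -lm lerDl.
  have := cS x y (Itv01 l0 l1) (mem_set Sx) (mem_set Sy).
  rewrite inE convE /=.
  by have -> : 1 - l = m by rewrite -lm addrC addKr.
rewrite !inE convE => Sx Sy; apply: cS => //.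
by rewrite addrC subrK.
Qed.

Lemma convexC_comb S l m (x y : R[i]) : convexC S -> 0 <= l -> 0 <= m ->
  S x -> S y -> exists2 z, S z & l%:C * x + m%:C * y = (l + m)%:C * z.
Proof.
move=> /convexCP cS l0 m0 Sx Sy; have [lm|lm] := eqVneq (l + m) 0.
  have /andP[/eqP -> /eqP ->] : (l == 0) && (m == 0).
    by rewrite -paddr_eq0 // lm.
  by exists x; rewrite // addr0 !mul0r addr0.
exists ((l / (l + m))%:C * x + (m / (l + m))%:C * y).
  by apply: cS; rewrite ?divr_ge0 ?addr_ge0 // -mulrDl divff.
by rewrite mulrDr !mulrA -!rmorphM /= ![_ * (_ / _)]mulrC !divfK.
Qed.

(** The weights need not add up to 1 and may all vanish; [x0] serves the empty sum. *)
Lemma convexC_sum S n (p : 'I_n -> R) (a : 'I_n -> R[i]) (x0 : R[i]) :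
  convexC S -> S x0 -> (forall i, 0 <= p i) -> (forall i, S (a i)) ->
  exists2 c, S c & \sum_(i < n) (p i)%:C * a i = (\sum_(i < n) p i)%:C * c.
Proof.
move=> cS Sx0; elim: n p a => [|n IH] p a p0 Sa.
  by exists x0; rewrite // !big_ord0 mul0r.
have [c Sc E] := IH (fun i => p (lift ord0 i)) (fun i => a (lift ord0 i))
  (fun i => p0 _) (fun i => Sa _).
rewrite !big_ord_recl E.
by apply: convexC_comb => //; apply: sumr_ge0.
Qed.

Lemma preimage_affine_convexC W (u d : R[i]) :
  convexC W -> convexC [set x | W (x * u + d)].
Proof.
move=> /convexCP cW; apply/convexCP => l m x y l0 m0 lm /= Wx Wy.
have -> : (l%:C * x + m%:C * y) * u + d =
    l%:C * (x * u + d) + m%:C * (y * u + d).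
  have lmC : l%:C + m%:C = 1 :> R[i] by rewrite -rmorphD lm.
  by rewrite -[X in _ + X = _]mul1r -lmC; ring.
exact: cW.
Qed.

(** Coefficients pass from [S] to its hull one at a time: with the others fixed, the values that
    keep the sum in [W] form a convex set, so it suffices that they include [S]. *)
Lemma convex_hull_sum S W n (u : 'I_n -> R[i]) : convexC W ->
  (forall a, (forall i, S (a i)) -> W (\sum_(i < n) a i * u i)) ->
  forall a, (forall i, convex_hull S (a i)) -> W (\sum_(i < n) a i * u i).
Proof.
elim: n u W => [|n IH] u W cW SW a ha; first by apply: SW => -[].
rewrite big_ord_recl; set d := \sum_(i < n) _.
have : convex_hull S `<=` [set x | W (x * u ord0 + d)].
  apply: smallest_sub; first exact: preimage_affine_convexC.
  move=> x Sx /=; rewrite addrC -[d]mulr1.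
  (* For a head coefficient [x] in [S], the tail falls under [IH] with [W] translated by
     [x * u ord0]. *)
  have cW' : convexC [set y | W (y * 1 + x * u ord0)].
    exact: preimage_affine_convexC.
  apply: (IH (fun i => u (lift ord0 i)) _ cW' _ (fun i => a (lift ord0 i))) => //.
  move=> b Sb /=; rewrite mulr1.
  have := SW (fun i => oapp b x (unlift ord0 i)).
  rewrite big_ord_recl unlift_none /= addrC.
  under eq_bigr do rewrite liftK /=.
  by apply=> i; case: (unlift ord0 i).
by apply; exact: ha.
Qed.

End Convexity.

(** * Bipolars for the convex hull, extreme directions for the reduction to two vectors *)

Section Main.
Variable R : realType.
Implicit Types (theta phi t : R) (S : set R[i]).

Lemma lt23pi_itv t : 0 < t < 2 * pi / 3 -> 0 < t < pi.
Proof.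
by move=> /andP[t0 t23]; have := pi_gt0 R => pi0; apply/andP; split; lra.
Qed.

(** Zero is excluded by hand, as it satisfies [near_dir] trivially. *)
Definition polar phi (V : set R[i]) : set R[i] :=
  [set v | v != 0 /\ forall w, V w -> near_dir (cot phi) v w].

(* Convexity of the bipolar uses that two of its points are close to each other,
   which holds as one of them can be taken in the larger set [polar phi V]. *)
Lemma polar_polar_convexC phi (V : set R[i]) : 0 < phi < 2 * pi / 3 ->
  V `<=` polar phi V ->
  polar phi (polar phi V) `<=` polar phi V /\ convexC (polar phi (polar phi V)).
Proof.
move=> hphi VV; have sub : polar phi (polar phi V) `<=` polar phi V.
  by move=> v [v0 hv]; split=> // w /VV; exact: hv.
split=> //; apply/convexCP => l m x y l0 m0 lm Px Py.
have [[x0 hx] [y0 hy]] := (Px, Py).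
have xy := hx _ (sub _ Py).
split; first by apply: near_dir_comb_neq0 xy => //; rewrite lm ltr01.
move=> w Pw; apply: near_dir_comb => //.
- exact: cot_lt23piP.
- by case: Pw.
- exact: hx.
- exact: hy.
Qed.

Lemma Aset_convex_hull theta phi S :
  0 < theta < 2 * pi / 3 -> 0 < phi < 2 * pi / 3 ->
  Aset theta phi S -> Aset theta phi (convex_hull S).
Proof.
move=> htheta hphi [S0 AS].
have main n (u a b : 'I_n -> R[i]) : (1 <= n)%N -> (forall i, Cstar (u i)) ->
    (forall i j, angle (u i) (u j) <= theta) ->
    (forall i, convex_hull S (a i)) -> (forall i, convex_hull S (b i)) ->
    let v := \sum_(i < n) a i * u i in let w := \sum_(i < n) b i * u i in
    [/\ v != 0, w != 0 & angle v w <= phi].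
  move=> n1 u0 hu ha hb /=.
  pose V := [set v | exists2 c : 'I_n -> R[i],
    forall i, S (c i) & v = \sum_(i < n) c i * u i].
  have VV : V `<=` polar phi V.
    move=> _ [c Sc ->]; have [v0 _ _] := AS n u c c n1 u0 hu Sc Sc.
    split=> // _ [d Sd ->]; have [_ w0] := AS n u c d n1 u0 hu Sc Sd.
    by rewrite angle_le // lt23pi_itv.
  have [sub cV] := polar_polar_convexC hphi VV.
  have inW c : (forall i, convex_hull S (c i)) ->
      polar phi (polar phi V) (\sum_(i < n) c i * u i).
    apply: convex_hull_sum => // d Sd.
    have Vd : V (\sum_(i < n) d i * u i) by exists d.
    have [d0 _] := VV _ Vd; split=> // w [_ hw].
    by apply: near_dirC; exact: hw.
  have [v0 hv] := inW _ ha; have [w0 _] := inW _ hb.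
  (* Both sums are in the bipolar; [sub] puts the second one in the polar, to which the first is
     close. *)
  by rewrite angle_le ?lt23pi_itv //; split=> //; apply: hv; apply: sub; exact: inW.
(* The case [n = 1] with [u = 1] shows that the hull avoids 0. *)
split=> // x hx.
have t0 : angle 1 1 <= theta.
  rewrite angle_le ?oner_eq0 ?lt23pi_itv // /near_dir /cross /dot /=.
  by rewrite !mulr0 mul0r subrr normr0 mulr0 addr0 mulr1.
have [] := main 1%N (fun=> 1) (fun=> x) (fun=> x) isT.
- by move=> i; rewrite /Cstar /= oner_eq0.
- by [].
- by [].
- by [].
- by rewrite big_ord_recl big_ord0 mulr1 addr0.
Qed.

Lemma extreme_pair n (u : 'I_n.+1 -> R[i]) t : cot_lt23pi t ->
  (forall i, u i != 0) -> (forall i j, near_dir t (u i) (u j)) ->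
  exists j k (p q : 'I_n.+1 -> R),
    [/\ forall i, 0 <= p i /\ 0 <= q i,
        forall i, u i = (p i)%:C * u j + (q i)%:C * u k,
        0 < \sum_i p i & 0 < \sum_i q i].
Proof.
move=> ht; elim: n u => [|n IH] u u0 uu.
  (* A single vector is both extremes; halving it keeps both sums positive. *)
  exists ord0, ord0, (fun=> 2^-1), (fun=> 2^-1); split.
  - by move=> i; rewrite invr_ge0 ler0n.
  - move=> i; rewrite ord1 -mulrDl -rmorphD /=.
    have -> : 2^-1 + 2^-1 = 1 :> R by lra.
    by rewrite mul1r.
  - by rewrite big_ord_recl big_ord0 addr0 invr_gt0 ltr0n.
  - by rewrite big_ord_recl big_ord0 addr0 invr_gt0 ltr0n.
have [j [k [p [q [pq0 E P0 Q0]]]]] :=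
  IH (fun i => u (lift ord0 i)) (fun i => u0 _) (fun i j => uu _ _).
pose ext (r : R) (f : 'I_n.+1 -> R) (i : 'I_n.+2) := oapp f r (unlift ord0 i).
have ext0 r f : ext r f ord0 = r by rewrite /ext unlift_none.
have extS r f i : ext r f (lift ord0 i) = f i by rewrite /ext liftK.
have sumE r f : \sum_i ext r f i = r + \sum_i f i.
  by rewrite big_ord_recl ext0; congr (_ + _); apply: eq_bigr => i _; exact: extS.
have sum_ge0 (f : 'I_n.+1 -> R) : (forall i, 0 <= f i) -> 0 <= \sum_i f i.
  by move=> f0; apply: sumr_ge0.
have ext_ge0 r f : 0 <= r -> (forall i, 0 <= f i) -> forall i, 0 <= ext r f i.
  by move=> r0 f0 i; rewrite /ext; case: unlift => [i'|] /=.
have build j' k' r s (f g : 'I_n.+1 -> R) : 0 <= r -> 0 <= s ->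
    (forall i, 0 <= f i) -> (forall i, 0 <= g i) ->
    u ord0 = r%:C * u j' + s%:C * u k' ->
    (forall i, u (lift ord0 i) = (f i)%:C * u j' + (g i)%:C * u k') ->
    0 < r + \sum_i f i -> 0 < s + \sum_i g i ->
    exists j k (p q : 'I_n.+2 -> R),
    [/\ forall i, 0 <= p i /\ 0 <= q i,
        forall i, u i = (p i)%:C * u j + (q i)%:C * u k,
        0 < \sum_i p i & 0 < \sum_i q i].
  move=> r0 s0 f0 g0 E0 ES Pf Pg.
  exists j', k', (ext r f), (ext s g); rewrite !sumE; split=> // i.
    by split; exact: ext_ge0.
  by case: (unliftP ord0 i) => [i' ->|->]; rewrite ?extS ?ext0.
have p0 i := (pq0 i).1; have q0 i := (pq0 i).2.
have [] := near_dir_in_cone ht (u0 (lift ord0 j)) (u0 (lift ord0 k)) (u0 ord0)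
  (uu _ _) (uu _ _) (uu _ _).
- move=> [r [s [r0 s0 Ez]]].
  apply: (build _ _ r s p q) => //; [exact: Ez | exact: ltr_wpDl | exact: ltr_wpDl].
(* The new vector replaces the first extreme one, and substituting [Ex] into [E] gives the new
   coefficients. *)
- move=> [r [s [r0 s0 Ex]]].
  apply: (build ord0 (lift ord0 k) 1 0 (fun i => p i * s) (fun i => p i * r + q i));
    rewrite ?ler01 ?lexx //.
  + by move=> i; rewrite mulr_ge0.
  + by move=> i; rewrite addr_ge0 ?mulr_ge0.
  + by rewrite mul1r mul0r addr0.
  + by move=> i; rewrite E Ex rmorphD !rmorphM /=; ring.
  + by rewrite ltr_wpDr ?ltr01 // sum_ge0 // => i; rewrite mulr_ge0.
  + rewrite add0r big_split /= ltr_wpDl // sum_ge0 // => i.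
    by rewrite mulr_ge0.
- move=> [r [s [r0 s0 Ey]]].
  apply: (build (lift ord0 j) ord0 0 1 (fun i => p i + q i * s) (fun i => q i * r));
    rewrite ?ler01 ?lexx //.
  + by move=> i; rewrite addr_ge0 ?mulr_ge0.
  + by move=> i; rewrite mulr_ge0.
  + by rewrite mul1r mul0r add0r.
  + by move=> i; rewrite E Ey rmorphD !rmorphM /=; ring.
  + rewrite add0r big_split /= ltr_wpDr // sum_ge0 // => i.
    by rewrite mulr_ge0.
  + by rewrite ltr_wpDr ?ltr01 // sum_ge0 // => i; rewrite mulr_ge0.
Qed.

Lemma A2set_convex_Aset theta phi S :
  0 < theta < 2 * pi / 3 -> 0 < phi < 2 * pi / 3 ->
  A2set theta phi S -> convexC S -> Aset theta phi S.
Proof.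
move=> htheta hphi [S0 A2] cS; split=> // -[//|n] u a b _ u0 hu Sa Sb v w.
have uu i j : near_dir (cot theta) (u i) (u j).
  by rewrite -angle_le ?lt23pi_itv //; exact: u0.
have [j [k [p [q [pq0 E P0 Q0]]]]] := extreme_pair (cot_lt23piP htheta) u0 uu.
set P := \sum_i p i in P0; set Q := \sum_i q i in Q0.
have real_neq0 (r : R) : 0 < r -> r%:C != 0 :> R[i].
  by move=> r0; rewrite eq_complex /= eqxx andbT gt_eqF.
have Px0 : P%:C * u j != 0 by rewrite mulf_neq0 ?real_neq0 //; exact: u0.
have Qy0 : Q%:C * u k != 0 by rewrite mulf_neq0 ?real_neq0 //; exact: u0.
pose z := (P%:C * u j) / (Q%:C * u k).
have sz : sector theta z.
  split; first by rewrite mulf_neq0 ?invr_eq0.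
  rewrite norm_arg_div // angle_le ?lt23pi_itv //.
  by apply: near_dirZ; rewrite ?ltW.
have two_points c : (forall i, S (c i)) -> exists2 c1, S c1 &
    exists2 c2, S c2 & \sum_i c i * u i = (Q%:C * u k) * (c1 * z + c2).
  move=> Sc.
  have [c1 Sc1 E1] := convexC_sum cS (Sc ord0) (fun i => (pq0 i).1) Sc.
  have [c2 Sc2 E2] := convexC_sum cS (Sc ord0) (fun i => (pq0 i).2) Sc.
  exists c1 => //; exists c2 => //.
  have -> : \sum_i c i * u i =
      (\sum_i (p i)%:C * c i) * u j + (\sum_i (q i)%:C * c i) * u k.
    rewrite !mulr_suml -big_split /=; apply: eq_bigr => i _.
    by rewrite {1}E; ring.
  rewrite E1 E2 -/P -/Q mulrDr [c1 * z]mulrC mulrA /z [_ * (_ / _)]mulrC.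
  by rewrite divfK //; ring.
have [c1 Sc1 [c2 Sc2 Ev]] := two_points a Sa.
have [d1 Sd1 [d2 Sd2 Ew]] := two_points b Sb.
have [den0 [ratio0 hratio]] := A2 _ _ _ _ Sc1 Sc2 Sd1 Sd2 z sz.
have num0 : c1 * z + c2 != 0.
  by apply: contra ratio0 => /eqP ->; rewrite mul0r.
have w0 : w != 0 by rewrite /w Ew mulf_neq0.
split=> //; first by rewrite /v Ev mulf_neq0.
(* The common factor [Q%:C * u k] cancels in [v / w], leaving the ratio bounded by [hratio]. *)
by rewrite -norm_arg_div // /v /w Ev Ew -mulf_div divff // mul1r.
Qed.

End Main.

Theorem theorem3p1 (R : realType) (theta phi : R)
    (htheta : 0 < theta < 2 * pi / 3) (hphi : 0 < phi < 2 * pi / 3)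
    (S : set R[i]) (hS : S `<=` @Cstar R) :
  (Aset theta phi S -> Aset theta phi (convex_hull S)) /\
  (A2set theta phi S -> convexC S -> Aset theta phi S).
Proof.
split; first exact: Aset_convex_hull.
exact: A2set_convex_Aset.
Qed.
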